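(* Let $0<\alpha<1$. Suppose that every agent $i$ measures its body velocities and the relative transformations $\mathbf T_{ij}$, $j\in\mathcal N_i$, and that the interaction graph $\mathcal G$ is undirected and connected. Let the matrices $\mathbf P_i(t)=\begin{bmatrix}\mathbf Q_i(t)&\mathbf q_i(t)\\ \mathbf 0&1\end{bmatrix}$, $i=1,\dots,n$, evolve under the finite-time frame localization law $$\dot{\mathbf P}_i(t)=-\begin{bmatrix}\mathbf v_i^i\\ \boldsymbol\omega_i^i\end{bmatrix}^{\wedge}\mathbf P_i(t)+\sum_{j\in\mathcal N_i}\frac{\mathbf T_{ij}(t)\mathbf P_j(t)-\mathbf P_i(t)}{\|\mathbf T_{ij}(t)\mathbf P_j(t)-\mathbf P_i(t)\|_F^\alpha},\qquad i=1,\dots,n.$$ Let $\hat{\mathbf R}_i^\top(t)$ be constructed from $\mathbf Q_i(t)$ by the Gram–Schmidt procedure, $\hat{\mathbf R}_i^\top(t)=\mathrm{GSOP}(\mathbf Q_i(t))$, let $\hat{\mathbf p}_i(t):=-\hat{\mathbf R}_i(t)\mathbf q_i(t)$, and $\hat{\mathbf T}_i(t):=\begin{bmatrix}\hat{\mathbf R}_i(t)&\hat{\mathbf p}_i(t)\\ \mathbf 0&1\end{bmatrix}$. Then, for almost all initializations $\{\mathbf P_i(0)\}_{i\in\mathcal V}$ (Lebesgue measure on the entries $(\mathbf Q_i(0),\mathbf q_i(0))_{i\in\mathcal V}$), there exists a constant transformation $\mathbf T_c\in SE(3)$, common to all agents, such that $\hat{\mathbf T}_i(t)\to\mathbf T_c^{-1}\mathbf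 T_i(t)$ in a finite time for all $i\in\mathcal V$; i.e. there is a finite $T\ge0$ with $\hat{\mathbf T}_i(t)=\mathbf T_c^{-1}\mathbf T_i(t)$ for all $t\ge T$ and all $i\in\mathcal V$.
   Context: There are $n$ agents in $\mathbb R^3$. Agent $i$ has a (time-varying, differentiable) pose $\mathbf T_i(t)=\begin{bmatrix}\mathbf R_i(t)&\mathbf p_i(t)\\ \mathbf 0&1\end{bmatrix}\in SE(3)$, with $\mathbf R_i\in SO(3)$, $\mathbf p_i\in\mathbb R^3$, satisfying $\dot{\mathbf T}_i=\mathbf T_i\begin{bmatrix}\mathbf v_i^i\\ \boldsymbol\omega_i^i\end{bmatrix}^{\wedge}$, where $\mathbf v_i^i,\boldsymbol\omega_i^i\in\mathbb R^3$ are the (possibly time-varying) linear and angular body velocities. Here $\begin{bmatrix}\mathbf v\\ \boldsymbol\omega\end{bmatrix}^{\wedge}=\begin{bmatrix}\boldsymbol\omega^\wedge&\mathbf v\\ \mathbf 0&0\end{bmatrix}\in\mathbb R^{4\times4}$ and $\boldsymbol\omega^\wedge\in\mathbb R^{3\times3}$ is the skew-symmetric matrix with $\boldsymbol\omega^\wedge\mathbf x=\boldsymbol\omega\times\mathbf x$. The relative transformation is $\mathbf T_{ij}=\mathbf T_i^{-1}\mathbf T_j$. The graph $\mathcal G=(\mathcal V,\mathcal E)$ has $\mathcal V=\{1,\dots,n\}$ and $\mathcal N_i=\{j:(i,j)\in\mathcal E\}$. Each $\mathbf P_i\in\mathbb R^{4\times4}$ has the displayed block form with $\mathbf Q_i\in\mathbb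 R^{3\times3}$, $\mathbf q_i\in\mathbb R^3$. $\|\cdot\|_F$ is the Frobenius norm. A summand in the law is taken to be $\mathbf 0$ when $\mathbf T_{ij}\mathbf P_j=\mathbf P_i$ (this makes the right-hand side continuous in the $\mathbf P_i$). GSOP: for a matrix with columns $\mathbf z_1,\mathbf z_2,\mathbf z_3\in\mathbb R^3$, set $\mathbf u_k=\mathbf z_k-\sum_{l<k}\langle\mathbf z_k,\mathbf y_l\rangle\mathbf y_l$, $\mathbf y_k=\mathbf u_k/\|\mathbf u_k\|$ for $k=1,2$, and $\mathbf y_3=\beta\,\mathbf u_3/\|\mathbf u_3\|$ with $\beta=\mathrm{sign}\det[\mathbf y_1,\mathbf y_2,\mathbf u_3/\|\mathbf u_3\|]$; if some $\mathbf u_k=\mathbf 0$, put $\mathbf y_k=\mathbf 0$. The output is $[\mathbf y_1,\mathbf y_2,\mathbf y_3]$, which lies in $SO(3)$ when the input is nonsingular. *)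

(* Defs.v *)
From mathcomp Require Import all_boot all_order all_algebra.
From mathcomp Require Import all_classical all_reals all_analysis measurable_realfun.
Import Order.TTheory GRing.Theory Num.Theory.
Import numFieldNormedType.Exports.

Set Implicit Arguments.
Unset Strict Implicit.
Unset Printing Implicit Defensive.

Local Open Scope classical_set_scope.
Local Open Scope ring_scope.

Section rigid_motions.
Context {R : realType}.

Definition frobnorm m n (A : 'M[R]_(m, n)) : R :=
  Num.sqrt (\sum_i \sum_j A i j ^+ 2).

Definition homog (A : 'M[R]_3) (b : 'cV[R]_3) : 'M[R]_(3 + 1) :=
  block_mx A b 0 1%:M.

Definition SO3 : set 'M[R]_3 := [set A | A^T *m A = 1%:M /\ \det A = 1].

Definition SE3 : set 'M[R]_(3 + 1) :=
  [set T | exists A b, SO3 A /\ T = homog A b].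

Definition hat3 (w : 'cV[R]_3) : 'M[R]_3 :=
  \matrix_(i, j) (nth [::] [:: [:: 0; - w 2%:R 0; w 1 0];
                               [:: w 2%:R 0; 0; - w 0 0];
                               [:: - w 1 0; w 0 0; 0]] i)`_j.

Definition wedge (v w : 'cV[R]_3) : 'M[R]_(3 + 1) := block_mx (hat3 w) v 0 0.

End rigid_motions.

Section gram_schmidt.
Context {R : realType}.

Definition dot (u v : 'cV[R]_3) : R := \sum_i u i 0 * v i 0.

(* The Frobenius norm of a column is its Euclidean norm; since 0^-1 = 0,
   normalize 0 = 0. *)
Definition normalize (u : 'cV[R]_3) : 'cV[R]_3 := (frobnorm u)^-1 *: u.

Definition mx_of_cols (y1 y2 y3 : 'cV[R]_3) : 'M[R]_3 :=
  \matrix_(i, j) [:: y1; y2; y3]`_j i 0.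

Definition gsop (Z : 'M[R]_3) : 'M[R]_3 :=
  let z1 := col 0 Z in
  let z2 := col 1 Z in
  let z3 := col 2%:R Z in
  let y1 := normalize z1 in
  let y2 := normalize (z2 - dot z2 y1 *: y1) in
  let n3 := normalize (z3 - (dot z3 y1 *: y1 + dot z3 y2 *: y2)) in
  mx_of_cols y1 y2 (Num.sg (\det (mx_of_cols y1 y2 n3)) *: n3).

End gram_schmidt.

Section localization.
Context {R : realType}.

(* f' is the derivative of f on the closed half-line [0, +oo[: two-sided at
   t > 0, one-sided at t = 0; the values of f at negative times are never
   used. *)
Definition is_derive_ge0 (V : normedModType R) (f f' : R -> V) : Prop :=
  forall t, 0 <= t ->
    h^-1 *: (f (t + h) - f t) @[h --> within [set h | 0 <= t + h] 0^']
      --> f' t.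

(* When Ti^-1 *m Tj *m Pj = Pi the matrix being scaled is 0, and so is the
   summand. *)
Definition coupling (alpha : R) (Ti Tj Pi Pj : 'M[R]_(3 + 1)) :
    'M[R]_(3 + 1) :=
  let D := invmx Ti *m Tj *m Pj - Pi in (frobnorm D `^ alpha)^-1 *: D.

Definition localization_law n (alpha : R) (E : rel 'I_n)
    (T : 'I_n -> R -> 'M[R]_(3 + 1)) (v w : 'I_n -> R -> 'cV[R]_3)
    (P : 'I_n -> R -> 'M[R]_(3 + 1)) : Prop :=
  forall i, is_derive_ge0 (P i) (fun t =>
    - wedge (v i t) (w i t) *m P i t
    + \sum_(j | E i j) coupling alpha (T i t) (T j t) (P i t) (P j t)).

Definition estimated_pose (Q : 'M[R]_3) (q : 'cV[R]_3) : 'M[R]_(3 + 1) :=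
  let Rhat := (gsop Q)^T in homog Rhat (- (Rhat *m q)).

End localization.

Section lebesgue.
Context {R : realType}.

(* Lebesgue measure on R^m: the m-fold product of the one-dimensional one,
   where, as in product_measure1, a product is the integral of the measures of
   the sections. *)
Fixpoint lebesgue_tuple (m : nat) :
    set (m.-tuple (measurableTypeR R)) -> \bar R :=
  match m with
  | 0 => fun A => \d_[tuple] A
  | k.+1 => fun A => (\int[lebesgue_measure]_x
      lebesgue_tuple [set t : k.-tuple (measurableTypeR R) |
                        A [tuple of x :: t]])%E
  end.

Lemma lebesgue_tuple0 m : @lebesgue_tuple m set0 = 0%E.
Proof.
elim: m => [|m IH] /=; first by rewrite diracE in_set0.
rewrite (_ : (fun=> _) = cst 0%E) ?integral0//; apply/funext => x /=.
by rewrite -[RHS]IH; congr lebesgue_tuple; apply/seteqP; split.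
Qed.

Lemma lebesgue_tuple_box m (a b : m.-tuple R) :
  (forall i, tnth a i <= tnth b i) ->
  lebesgue_tuple [set t | forall i, tnth a i <= tnth t i <= tnth b i] =
  (\prod_i (tnth b i - tnth a i))%:E.
Proof.
elim: m a b => [|m IH] a b ab.
  rewrite big_ord0 /= diracE mem_set// => i; by case: i.
case/tupleP: a ab => a0 a ab; case/tupleP: b ab => b0 b ab.
rewrite big_ord_recl !tnth0 /=.
transitivity (\int[lebesgue_measure]_x
   ((\prod_i (tnth b i - tnth a i))%:E * (\1_(`[a0, b0]%classic) x)%:E)%E)%E.
  apply: eq_integral => x _; rewrite indicE.
  have [|xab] := boolP (x \in _).
    rewrite inE/= in_itv/= => xab; rewrite mule1 -IH; last first.
      by move=> i; have := ab (lift ord0 i); rewrite !tnthS.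
    congr lebesgue_tuple; apply/seteqP; split => t /= h i.
      by have := h (lift ord0 i); rewrite !tnthS.
    by case: (unliftP ord0 i) => [j|] ->; rewrite ?tnthS ?tnth0.
  rewrite mule0 -[RHS](lebesgue_tuple0 m); congr lebesgue_tuple.
  apply/seteqP; split => t //= h; move: xab; rewrite notin_setE/= in_itv/=.
  by have := h ord0; rewrite !tnth0.
have h0 : 0 <= \prod_i (tnth b i - tnth a i).
  apply: prodr_ge0 => i _; rewrite subr_ge0.
  by have := ab (lift ord0 i); rewrite !tnthS.
rewrite ge0_integralZl//; last first.
  by apply/measurable_EFinP; exact: measurable_indic.
rewrite integral_indic//= setIT lebesgue_measure_itv/= lte_fin.
have := ab ord0; rewrite !tnth0 le_eqVlt => /orP[/eqP->|->].
  by rewrite ltxx mule0 subrr mul0r.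
rewrite -EFinD -EFinM mulrC; congr (_ * _)%:E.
by apply: eq_bigr => i _; rewrite !tnthS.
Qed.

(* The 12 free entries of each of the n matrices [Q_i q_i]. *)
Definition entry_index n := ('I_n * 'I_3 * 'I_(3 + 1))%type.

Definition entries n (x : #|{: entry_index n}|.-tuple (measurableTypeR R))
    (i : 'I_n) : 'M[R]_(3, 3 + 1) :=
  \matrix_(a, b) tnth x (enum_rank ((i, a, b) : entry_index n)).

End lebesgue.

(* Main.v *)
Require Import Defs.
From mathcomp Require Import all_boot all_order all_algebra.
From mathcomp Require Import all_classical all_reals all_analysis.
From mathcomp Require Import measurable_realfun.
From mathcomp Require Import ring lra.
Import Order.TTheory GRing.Theory Num.Theory.
Import numFieldNormedType.Exports.

Set Implicit Arguments.
Unset Strict Implicit.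
Unset Printing Implicit Defensive.

Local Open Scope classical_set_scope.
Local Open Scope ring_scope.

(** In the inertial frame the law becomes a consensus protocol. Put
    S_i = T_i P_i. The velocity term of the law cancels the kinematics of T_i,
    and a rigid motion preserves the Frobenius norm of a difference of two
    homogeneous matrices, whose last row is 0; hence
      S_i' = sum_(j ~ i) (S_j - S_i) / |S_j - S_i|^alpha,
    with no trace of the motion of the agents (inertial_flow).

    This protocol reaches agreement in finite time (finite_time_consensus). The
    edge terms are antisymmetric, so the mean M of the S_i is constant. The
    Lyapunov function V = sum_i |S_i - M|^2 satisfies
      V' = - sum_(i, j, i ~ j) |S_j - S_i|^(2 - alpha) <= - c V^(1 - alpha/2),
    because in a connected graph the edge differences control all differences.
    As the exponent 1 - alpha/2 is less than 1, V^(alpha/2) decreases at least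
    linearly as long as it is positive, and V vanishes after a finite time
    (finite_time_extinction).

    From then on T_i P_i is the constant matrix M, of rotation block Y and
    translation p, so that Q_i = R_i^T Y. Gram-Schmidt commutes with rotations
    (gsop_mulmx) and maps invertible matrices into SO(3) (gsop_SO3), so the
    estimated pose is T_c^-1 T_i, where T_c has rotation gsop Y and translation
    p (estimated_pose_consensus).

    All this needs only that Y, the mean of the R_i(0) Q_i(0), be invertible.
    The determinant of Y is an affine function of each single initial entry and
    is not identically 0, so by Fubini its zero set is a null set
    (lebesgue_tuple_coordinate_affine). *)

(** * Rigid motions and the Frobenius norm *)

Section rigid_motion_lemmas.
Context {R : realType}.
Implicit Types (A B Q Z : 'M[R]_3) (b q u : 'cV[R]_3).

Lemma sqr_frobnorm m n (A : 'M[R]_(m, n)) :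
  frobnorm A ^+ 2 = \sum_i \sum_j A i j ^+ 2.
Proof.
rewrite sqr_sqrtr// sumr_ge0// => i _.
by apply: sumr_ge0 => j _; rewrite sqr_ge0.
Qed.

Lemma frobnorm_ge0 m n (A : 'M[R]_(m, n)) : 0 <= frobnorm A.
Proof. exact: sqrtr_ge0. Qed.

Lemma frobnormE m n (A : 'M[R]_(m, n)) : frobnorm A = Num.sqrt (\tr (A^T *m A)).
Proof.
congr Num.sqrt; rewrite exchange_big; apply: eq_bigr => j _.
by rewrite mxE; apply: eq_bigr => i _; rewrite mxE expr2.
Qed.

Lemma homogM A b B c : homog A b *m homog B c = homog (A *m B) (A *m c + b).
Proof.
by rewrite /homog mulmx_block !mul0mx !mulmx0 !mulmx1 !addr0 add0r.
Qed.

Lemma homog1 : homog 1%:M 0 = 1%:M :> 'M[R]_(3 + 1).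
Proof. by rewrite /homog -scalar_mx_block. Qed.

Lemma homog_inj A b B c : homog A b = homog B c -> A = B /\ b = c.
Proof. by move/eq_block_mx => []. Qed.

Lemma SO3_trmx A : SO3 A -> SO3 A^T.
Proof. by move=> [AA dA]; split; rewrite ?det_tr// trmxK; exact: mulmx1C. Qed.

Lemma SO3_mulmx_tr A : SO3 A -> A *m A^T = 1%:M.
Proof. by move=> [/mulmx1C]. Qed.

Lemma homog_unit A b : SO3 A -> homog A b \in unitmx.
Proof. by move=> [_ dA]; rewrite unitmxE det_ublock dA det1 mulr1 unitr1. Qed.

Lemma invmx_homog A b : SO3 A -> invmx (homog A b) = homog A^T (- (A^T *m b)).
Proof.
move=> SA; have H : homog A b *m homog A^T (- (A^T *m b)) = 1%:M.
  rewrite homogM mulmxN mulmxA (SO3_mulmx_tr SA) mul1mx addNr; exact: homog1.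
by rewrite -[RHS]mul1mx -(mulVmx (homog_unit b SA)) -mulmxA H mulmx1.
Qed.

Lemma homogB A b B c :
  homog A b - homog B c = block_mx (A - B) (b - c) 0 0 :> 'M[R]_(3 + 1).
Proof. by rewrite /homog opp_block_mx add_block_mx !subrr. Qed.

Lemma mul_homog_block A b B c :
  homog A b *m block_mx B c 0 0 =
  block_mx (A *m B) (A *m c) 0 0 :> 'M[R]_(3 + 1).
Proof. by rewrite /homog mulmx_block !mul0mx !mulmx0 !addr0. Qed.

(** For a vanishing last row only the rotation acts, and it preserves the trace
    of X^T X. *)
Lemma frobnorm_homog_block A b B c : SO3 A ->
  frobnorm (homog A b *m block_mx B c 0 0) =
  frobnorm (block_mx B c 0 0 : 'M[R]_(3 + 1)).
Proof.
move=> [AA _]; rewrite mul_homog_block !frobnormE !tr_block_mx !mulmx_block.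
by rewrite !trmx_mul !mulmxA -!(mulmxA _ A^T A) AA !mulmx1.
Qed.

(** The change to the inertial frame: T_i cancels the T_i^-1 of the coupling,
    and the weight, a function of a norm, does not change. *)
Lemma mul_homog_coupling (alpha : R) A b B c Q q Q' q' :
  SO3 A -> SO3 B ->
  homog A b *m coupling alpha (homog A b) (homog B c) (homog Q q) (homog Q' q')
  = let S := homog A b *m homog Q q in
    let S' := homog B c *m homog Q' q' in
    (frobnorm (S' - S) `^ alpha)^-1 *: (S' - S).
Proof.
move=> SA SB /=; rewrite /coupling -scalemxAr.
set D := _ - homog Q q.
have TD : homog A b *m D
    = homog B c *m homog Q' q' - homog A b *m homog Q q.
  by rewrite mulmxBr -mulmxA mulKVmx ?homog_unit.
suff <- : frobnorm (homog A b *m D) = frobnorm D by rewrite TD.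
by rewrite /D invmx_homog// !homogM homogB frobnorm_homog_block.
Qed.

End rigid_motion_lemmas.

(** * The Gram-Schmidt procedure *)

Section gram_schmidt_lemmas.
Context {R : realType}.
Implicit Types (A B Q Z : 'M[R]_3) (b q u v : 'cV[R]_3).

Lemma dotE u v : dot u v = (u^T *m v) 0 0.
Proof. by rewrite mxE; apply: eq_bigr => i _; rewrite mxE. Qed.

Lemma dotC u v : dot u v = dot v u.
Proof. by apply: eq_bigr => i _; rewrite mulrC. Qed.

Lemma dotDl u v w : dot (u + v) w = dot u w + dot v w.
Proof. by rewrite !dotE linearD mulmxDl mxE. Qed.

Lemma dotZl a u v : dot (a *: u) v = a * dot u v.
Proof. by rewrite !dotE linearZ /= -scalemxAl mxE. Qed.

Lemma dotNl u v : dot (- u) v = - dot u v.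
Proof. by rewrite !dotE linearN mulNmx mxE. Qed.

Lemma dot_frobnorm u : dot u u = frobnorm u ^+ 2.
Proof.
by rewrite sqr_frobnorm; apply: eq_bigr => i _; rewrite big_ord1 expr2.
Qed.

Lemma frobnorm_eq0 u : frobnorm u = 0 -> u = 0.
Proof.
move=> u0; apply/matrixP => i j; rewrite ord1 mxE; apply/eqP.
have := sqr_frobnorm u; rewrite u0 expr0n/= => /esym/eqP.
rewrite psumr_eq0 => [|k _]; last by rewrite big_ord1 sqr_ge0.
by move=> /allP/(_ i (mem_index_enum _)); rewrite big_ord1 sqrf_eq0.
Qed.

Lemma frobnorm_normalize u : frobnorm u *: normalize u = u.
Proof.
rewrite /normalize scalerA; have [u0|u0] := eqVneq (frobnorm u) 0.
  by rewrite (frobnorm_eq0 u0) scaler0.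
by rewrite divff// scale1r.
Qed.

(** The hypothesis excludes u = 0, for which normalize u = 0. *)
Lemma dot_normalize u : normalize u != 0 -> dot (normalize u) (normalize u) = 1.
Proof.
move=> nu; have u0 : frobnorm u != 0.
  by apply: contraNneq nu => /frobnorm_eq0 ->; rewrite /normalize scaler0.
by rewrite /normalize dotZl dotC dotZl dot_frobnorm expr2 mulKf// mulVf.
Qed.

Lemma col_mx_of_cols (y1 y2 y3 : 'cV[R]_3) (j : 'I_3) :
  col j (mx_of_cols y1 y2 y3) = [:: y1; y2; y3]`_j.
Proof. by apply/matrixP => i k; rewrite !mxE ord1. Qed.

Lemma mulmx_cols B (y1 y2 y3 : 'cV[R]_3) :
  B *m mx_of_cols y1 y2 y3 = mx_of_cols (B *m y1) (B *m y2) (B *m y3).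
Proof.
apply/matrixP => i j; rewrite !mxE.
case: j => -[|[|[|//]]] ?; rewrite /= mxE; apply: eq_bigr => k _;
  by rewrite mxE.
Qed.

Lemma dot_mulmx B u v : SO3 B -> dot (B *m u) (B *m v) = dot u v.
Proof.
by move=> [BB _]; rewrite !dotE trmx_mul mulmxA -(mulmxA _ B^T) BB mulmx1.
Qed.

Lemma normalize_mulmx B u : SO3 B -> normalize (B *m u) = B *m normalize u.
Proof.
move=> [BB _]; rewrite /normalize -scalemxAr; congr (_^-1 *: _).
by rewrite !frobnormE trmx_mul mulmxA -(mulmxA _ B^T) BB mulmx1.
Qed.

(** Every step of the procedure uses only inner products, norms, linear
    combinations and the sign of a determinant; B preserves all of them, the
    sign because its determinant is 1. *)
Lemma gsop_mulmx B Z : SO3 B -> gsop (B *m Z) = B *m gsop Z.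
Proof.
move=> SB; have cB j : col j (B *m Z) = B *m col j Z.
  by apply/matrixP => a b; rewrite !mxE; apply: eq_bigr => k _; rewrite mxE.
rewrite /gsop !cB !(normalize_mulmx, dot_mulmx)//.
set y1 := normalize _.
rewrite scalemxAr -mulmxBr !(normalize_mulmx, dot_mulmx)//.
set y2 := normalize _.
rewrite !scalemxAr -mulmxDr -mulmxBr !(normalize_mulmx, dot_mulmx)//.
set y3 := normalize _.
by rewrite -mulmx_cols detM SB.2 mul1r scalemxAr -mulmx_cols.
Qed.

Lemma mx_of_cols_ortho (y1 y2 y3 : 'cV[R]_3) :
  dot y1 y1 = 1 -> dot y2 y2 = 1 -> dot y3 y3 = 1 ->
  dot y2 y1 = 0 -> dot y3 y1 = 0 -> dot y3 y2 = 0 ->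
  (mx_of_cols y1 y2 y3)^T *m mx_of_cols y1 y2 y3 = 1%:M.
Proof.
move=> h11 h22 h33 h21 h31 h32; apply/matrixP => i j; rewrite [RHS]mxE.
transitivity (dot [:: y1; y2; y3]`_i [:: y1; y2; y3]`_j).
  by rewrite mxE; apply: eq_bigr => k _; rewrite !mxE.
by case: i => -[|[|[|//]]] ?; case: j => -[|[|[|//]]] ? //=; rewrite 1?dotC.
Qed.

(** An orthonormal frame has determinant 1 or -1; scaling the last vector by
    this sign makes it direct. *)
Lemma orient_SO3 (y1 y2 y3 : 'cV[R]_3) :
  dot y1 y1 = 1 -> dot y2 y2 = 1 -> dot y3 y3 = 1 ->
  dot y2 y1 = 0 -> dot y3 y1 = 0 -> dot y3 y2 = 0 ->
  SO3 (mx_of_cols y1 y2 (Num.sg (\det (mx_of_cols y1 y2 y3)) *: y3)).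
Proof.
move=> d11 d22 d33 d21 d31 d32; set Y := mx_of_cols y1 y2 y3; set s := Num.sg _.
have YY : Y^T *m Y = 1%:M by exact: mx_of_cols_ortho.
have dY2 : \det Y ^+ 2 = 1 by rewrite -(det1 R 3) -YY detM det_tr expr2.
have s2 : s ^+ 2 = 1 by rewrite sqr_sg -sqrf_eq0 dY2 oner_eq0.
split.
  apply: mx_of_cols_ortho => //; rewrite ?dotZl ?d31 ?d32 ?mulr0//.
  by rewrite dotC dotZl d33 mulr1 -expr2.
(* Scaling a column is a product with a diagonal matrix on the right. *)
have -> : mx_of_cols y1 y2 (s *: y3) =
    Y *m mx_of_cols (delta_mx 0 0) (delta_mx 1 0) (s *: delta_mx 2%:R 0).
  apply/matrixP => i j.
  rewrite !mxE !big_ord_recl big_ord0 !mxE /= !addr0.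
  by case: j => -[|[|[|//]]] ? /=; rewrite !mxE /=; ring.
rewrite det_mulmx.
have -> : \det (mx_of_cols (delta_mx 0 0) (delta_mx 1 0)
    (s *: delta_mx 2%:R 0)) = s.
  rewrite -det_tr det_trig; last first.
    apply/is_trig_mxP => i j ij; rewrite !mxE; move: ij.
    case: i => -[|[|[|//]]] ?; case: j => -[|[|[|//]]] ? //=;
    by rewrite !mxE ?mulr0.
  by rewrite !big_ord_recl big_ord0 !mxE /=; ring.
rewrite mulrC -normrEsg; apply/eqP.
by rewrite -(@eqrXn2 _ 2)// -normrX dY2 normr1 expr1n.
Qed.

(** Whether or not some u_k vanishes, Z factors as Y U with U upper triangular.
    So Y is invertible when Z is, which rules out the zero columns by which the
    procedure encodes failure. *)
Lemma gsop_SO3 Z : \det Z != 0 -> SO3 (gsop Z).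
Proof.
rewrite /gsop; set z1 := col 0 Z; set z2 := col 1 Z; set z3 := col _ Z.
set y1 := normalize z1.
set u2 := z2 - _; set y2 := normalize u2.
set u3 := z3 - _; set y3 := normalize u3.
move=> dZ; set Y := mx_of_cols y1 y2 y3.
pose U : 'M[R]_3 := mx_of_cols
  (\col_i [:: frobnorm z1; 0; 0]`_i)
  (\col_i [:: dot z2 y1; frobnorm u2; 0]`_i)
  (\col_i [:: dot z3 y1; dot z3 y2; frobnorm u3]`_i).
have ZYU : Z = Y *m U.
  have z1E : z1 = frobnorm z1 *: y1 by rewrite frobnorm_normalize.
  have z2E : z2 = dot z2 y1 *: y1 + frobnorm u2 *: y2.
    by rewrite frobnorm_normalize addrC subrK.
  have z3E : z3 = dot z3 y1 *: y1 + dot z3 y2 *: y2 + frobnorm u3 *: y3.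
    by rewrite frobnorm_normalize addrC subrK.
  apply/matrixP => i j.
  have -> : Z i j = [:: z1; z2; z3]`_j i 0.
    by case: j => -[|[|[|//]]] ? /=; rewrite mxE; congr (Z _ _); apply/val_inj.
  rewrite mxE !big_ord_recl big_ord0 !mxE /= !addr0.
  case: j => -[|[|[|//]]] ? /=.
  - by rewrite {1}z1E !mxE /=; ring.
  - by rewrite {1}z2E !mxE /=; ring.
  - by rewrite {1}z3E !mxE /=; ring.
have dY : \det Y != 0.
  by apply: contraNneq dZ; rewrite ZYU detM => ->; rewrite mul0r.
have colY j : col j Y != 0.
  apply: contraNneq dY => cj; rewrite (expand_det_col _ j) big1// => i _.
  by have /matrixP/(_ i 0) := cj; rewrite !mxE => ->; rewrite mul0r.
have d11 : dot y1 y1 = 1.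
  by apply: dot_normalize; have := colY 0; rewrite col_mx_of_cols.
have d22 : dot y2 y2 = 1.
  by apply: dot_normalize; have := colY 1; rewrite col_mx_of_cols.
have d33 : dot y3 y3 = 1.
  by apply: dot_normalize; have := colY 2%:R; rewrite col_mx_of_cols.
have d21 : dot y2 y1 = 0.
  by rewrite /y2 /normalize dotZl /u2 dotDl dotNl dotZl d11 mulr1 subrr mulr0.
have d31 : dot y3 y1 = 0.
  rewrite /y3 /normalize dotZl /u3 dotDl dotNl dotDl (dotZl _ y1) (dotZl _ y2).
  by rewrite d11 d21 mulr1 mulr0 addr0 subrr mulr0.
have d32 : dot y3 y2 = 0.
  rewrite /y3 /normalize dotZl /u3 dotDl dotNl dotDl (dotZl _ y1) (dotZl _ y2).
  by rewrite d22 (dotC y1) d21 mulr1 mulr0 add0r subrr mulr0.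
exact: orient_SO3.
Qed.

End gram_schmidt_lemmas.

(** * Null sets of functions affine in each coordinate *)

Section coordinate_affine.
Context {R : realType}.

Definition set_coord m (t : m.-tuple R) (i : 'I_m) (y : R) : m.-tuple R :=
  [tuple if k == i then y else tnth t k | k < m].

(** What is used of the determinant: a line parallel to an axis lies in the zero
    set or meets it in at most one point. *)
Definition coordinate_affine m (f : m.-tuple R -> R) :=
  forall t i, exists a b, forall y, f (set_coord t i y) = a + b * y.

Lemma set_coord_cons0 m (x y : R) (t : m.-tuple R) :
  set_coord [tuple of x :: t] ord0 y = [tuple of y :: t].
Proof.
apply: eq_from_tnth => k; rewrite tnth_mktuple.
by case: (unliftP ord0 k) => [j|] ->; rewrite ?tnthS ?tnth0.
Qed.

Lemma set_coord_consS m (x y : R) (t : m.-tuple R) (i : 'I_m) :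
  set_coord [tuple of x :: t] (lift ord0 i) y = [tuple of x :: set_coord t i y].
Proof.
apply: eq_from_tnth => k; rewrite tnth_mktuple.
case: (unliftP ord0 k) => [j|] ->; rewrite ?tnthS ?tnth0//.
by rewrite (inj_eq (@lift_inj _ _)) tnth_mktuple.
Qed.

Lemma coordinate_affine_section m (f : m.+1.-tuple R -> R) (x : R) :
  coordinate_affine f -> coordinate_affine (fun t => f [tuple of x :: t]).
Proof.
move=> af t i; have [a [b ab]] := af [tuple of x :: t] (lift ord0 i).
by exists a, b => y; rewrite -ab set_coord_consS.
Qed.

(** If the sections at two distinct abscissae vanished identically, then so
    would every function y |-> f (y :: t), which is affine with two zeros. *)
Lemma null_section_unique m (f : m.+1.-tuple R -> R) (x1 x2 : R) :
  coordinate_affine f -> (exists t, f t != 0) ->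
  (forall t : m.-tuple R, f [tuple of x1 :: t] = 0) ->
  (forall t : m.-tuple R, f [tuple of x2 :: t] = 0) -> x1 = x2.
Proof.
move=> af [t]; case/tupleP: t => x t ft n1 n2.
have [a [b ab]] := af [tuple of x :: t] ord0.
have abE y : f [tuple of y :: t] = a + b * y by rewrite -ab set_coord_cons0.
have b0 : b != 0.
  apply: contraNneq ft => b0; have := n1 t.
  by rewrite !abE b0 !mul0r => ->.
by apply: (mulfI b0); apply: (addrI a); rewrite -!abE n1 n2.
Qed.

(** Induction on the dimension: with at most one exception the sections of f in
    the first coordinate are not identically 0, so their zero sets are null, and
    a single point does not contribute to the integral. *)
Lemma lebesgue_tuple_coordinate_affine m
    (f : m.-tuple (measurableTypeR R) -> R) :
  coordinate_affine f -> (exists t, f t != 0) ->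
  lebesgue_tuple [set t | f t = 0] = 0%E.
Proof.
elim: m f => [|m IH] f af f0 /=.
  case: f0 => t; rewrite (tuple0 t) => ft.
  by rewrite diracE memNset//=; exact/eqP.
set F := fun x => lebesgue_tuple _.
have F0 x : (exists t : m.-tuple R, f [tuple of x :: t] != 0) -> F x = 0%E.
  by move=> h; apply: IH h; exact: coordinate_affine_section.
have [[x0 hx0]|nx0] := pselect (exists x, F x != 0%E); last first.
  rewrite (_ : F = cst 0%E) ?integral0//; apply/funext => x.
  by apply/eqP; apply/negP => /negP Fx; apply: nx0; exists x.
have bad x : F x != 0%E -> forall t : m.-tuple R, f [tuple of x :: t] = 0.
  move=> Fx t; apply/eqP; apply/negP => /negP ft; move/negP: Fx; apply.
  by apply/eqP; apply: F0; exists t.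
rewrite (_ : F = F \_ [set x0]).
  by rewrite -integral_mkcond integral_set1.
apply/funext => x; rewrite /patch; case: ifPn => //.
rewrite notin_setE/= => xx0; apply/eqP; apply/negP => /negP Fx; apply: xx0.
exact: (null_section_unique af f0 (bad _ Fx) (bad _ hx0)).
Qed.

End coordinate_affine.

(** * Almost all initializations have an invertible mean *)

Section initial_average.
Context {R : realType} (n : nat).
Implicit Types (B : 'I_n -> 'M[R]_3).
Local Notation N := #|{: entry_index n}|.

(** For B_i = R_i(0), this is n times the rotation block of the consensus
    value. *)
Definition weighted_sum B (x : N.-tuple (measurableTypeR R)) : 'M[R]_3 :=
  \sum_i B i *m lsubmx (entries x i).

Lemma weighted_sumE B x (a b : 'I_3) : weighted_sum B x a b =
  \sum_i \sum_c B i a c *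
    tnth x (enum_rank ((i, c, lshift 1 b) : entry_index n)).
Proof.
rewrite summxE; apply: eq_bigr => i _; rewrite mxE; apply: eq_bigr => c _.
by rewrite !mxE.
Qed.

Lemma measurable_det_weighted_sum B :
  measurable_fun setT (fun x => \det (weighted_sum B x)).
Proof.
apply: measurable_sum => s; apply: measurable_funM; first exact: measurable_cst.
apply: measurable_prod => a _; under eq_fun do rewrite weighted_sumE.
apply: measurable_sum => i; apply: measurable_sum => c.
apply: measurable_funM; first exact: measurable_cst.
exact: measurable_tnth.
Qed.

(** An entry in column b of some Q_i acts only on column b of the sum, and the
    determinant is linear in each column; an entry of some q_i does not act. *)
Lemma coordinate_affine_det_weighted_sum B :
  coordinate_affine (fun x => \det (weighted_sum B x)).
Proof.
move=> t k; have [[[i a] b] kE] : exists e : entry_index n, k = enum_rank e.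
  by exists (enum_val k); rewrite enum_valK.
pose W y := weighted_sum B (set_coord t k y).
have tE y e : tnth (set_coord t k y) (enum_rank e) =
    if e == (i, a, b) then y else tnth t (enum_rank e).
  by rewrite tnth_mktuple kE (inj_eq enum_rank_inj).
have affW y r s : W y r s = W 0 r s +
    (\sum_j \sum_c B j r c *
      ((j, c, lshift 1 s) == (i, a, b) :> entry_index n)%:R) * y.
  rewrite /W !weighted_sumE mulr_suml -big_split; apply: eq_bigr => j _ /=.
  rewrite mulr_suml -big_split; apply: eq_bigr => c _ /=; rewrite !tE.
  by case: eqP => _ /=; ring.
have W0 y r s : lshift 1 s != b -> W y r s = W 0 r s.
  move=> sb; rewrite affW big1 ?mul0r ?addr0// => j _; rewrite big1// => c _.
  by rewrite !xpair_eqE (negPf sb) andbF mulr0.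
case: (split_ordP b) => [s bE|s bE]; last first.
  exists (\det (W 0)), 0 => y; rewrite mul0r addr0; congr (\det _).
  by apply/matrixP => r u; apply: W0; rewrite bE eq_lrshift.
exists (\sum_r W 0 r s * cofactor (W 0) r s), (\sum_r (\sum_j \sum_c B j r c *
      ((j, c, lshift 1 s) == (i, a, b) :> entry_index n)%:R) *
        cofactor (W 0) r s) => y.
rewrite (expand_det_col _ s) mulr_suml -big_split; apply: eq_bigr => r _ /=.
rewrite -/(W y).
have -> : cofactor (W y) r s = cofactor (W 0) r s.
  rewrite /cofactor; congr (_ * \det _); apply/matrixP => p u; rewrite !mxE.
  by apply: W0; rewrite bE (inj_eq (@lshift_inj _ _)) eq_sym neq_lift.
by rewrite affW; ring.
Qed.

(** The determinant does not vanish at the initialization Q_i = B_i^T, q_i = 0,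
    for which the sum is n times the identity. *)
Lemma det_weighted_sum_ae B : (0 < n)%N -> (forall i, SO3 (B i)) ->
  {ae @lebesgue_tuple R N, forall x, \det (weighted_sum B x) != 0}.
Proof.
move=> n0 SB; exists [set x | \det (weighted_sum B x) = 0]; split.
- rewrite -[X in measurable X]setTI.
  exact: (@measurable_det_weighted_sum B measurableT _ (measurable_set1 0)).
- apply: lebesgue_tuple_coordinate_affine.
    exact: coordinate_affine_det_weighted_sum.
  exists [tuple (let: (i, a, b) := (enum_val k : entry_index n) in
    if fintype.split b is inl b' then (B i)^T a b' else 0) | k < N].
  rewrite (_ : weighted_sum _ _ = n%:R%:M).
    by rewrite det_scalar expf_neq0// pnatr_eq0 -lt0n.
  apply/matrixP => a b; rewrite weighted_sumE.
  transitivity (\sum_(i < n) (1%:M : 'M[R]_3) a b).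
    apply: eq_bigr => i _; rewrite -(SO3_mulmx_tr (SB i)) mxE.
    apply: eq_bigr => c _; rewrite tnth_mktuple enum_rankK.
    by rewrite (unsplitK (inl b)).
  by rewrite sumr_const card_ord !mxE -mulrnA mulnC mulrnA.
- by move=> x /=; move/negP; rewrite negbK => /eqP.
Qed.

End initial_average.

(** * Differential inequalities on the half-line *)

Section half_line_derivatives.
Context {R : realType}.
Implicit Types (f g : R -> R).

(** Weaker at 0 than a one-sided derivative, but all that the mean value theorem
    requires, and stable under sums and products by the two-sided rules. *)
Definition half_line_derive f f' : Prop :=
  f x @[x --> 0^'+] --> f 0 /\ forall t : R, 0 < t -> is_derive t 1 f (f' t).

(** The increments h with 0 <= t + h contain a punctured neighbourhood of 0 when
    t > 0, and a right neighbourhood of 0 when t = 0. *)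
Lemma half_line_derive_entry (F F' : R -> 'M[R]_(3 + 1)) i j :
  is_derive_ge0 F F' -> half_line_derive (fun t => F t i j) (fun t => F' t i j).
Proof.
move=> dF; pose q t h := h^-1 * (F (t + h) i j - F t i j).
have dq t : 0 <= t ->
    q t h @[h --> within [set h | 0 <= t + h] 0^'] --> F' t i j.
  move=> t0.
  rewrite (_ : q t = (fun A : 'M[R]_(3 + 1) => A i j) \o
                     (fun h => h^-1 *: (F (t + h) - F t))).
    exact: cvg_comp (dF t t0) (@coord_continuous R _ _ i j (F' t)).
  by apply/funext => h; rewrite /q /= !mxE.
split.
  have q0 : q 0 h @[h --> 0^'+] --> F' 0 i j.
    apply: cvg_trans (dq 0 (lexx _)); apply: cvg_app => A.
    apply: (@filterS _ (nbhs (0 : R))) => h /= H h0.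
    apply: H; first by rewrite gt_eqF.
    by rewrite add0r ltW.
  have c : F 0 i j + h * q 0 h @[h --> 0^'+] --> F 0 i j + 0 * F' 0 i j.
    apply: cvgD; first exact: cvg_cst.
    by apply: cvgM => //; exact: cvg_within.
  rewrite mul0r addr0 in c; apply: cvg_trans c.
  apply: near_eq_cvg; near=> h; have h0 : 0 < h by [].
  by rewrite /q add0r mulVKf ?gt_eqF// addrC subrK.
move=> t t0.
have qt : q t h @[h --> 0^'] --> F' t i j.
  apply: cvg_trans (dq t (ltW t0)); apply: cvg_app => A.
  have nt : \forall h \near (0 : R), - t < h.
    by apply: lt_nbhsr; rewrite oppr_lt0.
  apply: (@filterS2 _ (nbhs (0 : R))) nt => h th H h0; apply: H => //.
  by rewrite /= -(subrr t) lerD2l ltW.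
have e : (fun h => h^-1 *:
    (((fun t => F t i j) \o shift t) (h *: 1) - F t i j)) = q t.
  by apply/funext => h; rewrite /q /= [h *: 1]mulr1 (addrC h).
apply: DeriveDef.
  by apply/cvg_ex; exists (F' t i j); rewrite /= e.
by rewrite /derive e; exact/cvg_lim.
Unshelve. all: by end_near. Qed.

Lemma half_line_derive_cst (c : R) : half_line_derive (fun=> c) (fun=> 0).
Proof. by split=> [|t t0]; [exact: cvg_cst|exact: is_derive_cst]. Qed.

Lemma half_line_derive_eq f f' g' : (forall t, 0 < t -> f' t = g' t) ->
  half_line_derive f f' -> half_line_derive f g'.
Proof. by move=> e [f0 df]; split=> // t t0; rewrite -e//; exact: df. Qed.

Lemma half_line_deriveD f f' g g' :
  half_line_derive f f' -> half_line_derive g g' ->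
  half_line_derive (fun t => f t + g t) (fun t => f' t + g' t).
Proof.
move=> [f0 df] [g0 dg]; split=> [|t t0]; first exact: cvgD.
by apply: is_deriveD; [exact: df|exact: dg].
Qed.

Lemma half_line_deriveM f f' g g' :
  half_line_derive f f' -> half_line_derive g g' ->
  half_line_derive (fun t => f t * g t) (fun t => f t * g' t + f' t * g t).
Proof.
move=> [f0 df] [g0 dg]; split=> [|t t0]; first exact: cvgM.
rewrite [f' t * _]mulrC; apply: is_deriveM; [exact: df|exact: dg].
Qed.

Lemma half_line_derive_sum (I : Type) (r : seq I) (f f' : I -> R -> R) :
  (forall i, half_line_derive (f i) (f' i)) ->
  half_line_derive (fun t => \sum_(i <- r) f i t)
                   (fun t => \sum_(i <- r) f' i t).
Proof.
move=> df; elim: r => [|i r IH].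
  under eq_fun do rewrite big_nil.
  under [X in half_line_derive _ X]eq_fun do rewrite big_nil.
  exact: half_line_derive_cst.
under eq_fun do rewrite big_cons.
under [X in half_line_derive _ X]eq_fun do rewrite big_cons.
exact: half_line_deriveD.
Qed.

Lemma le_of_derive_le0 f f' (a b : R) : a <= b ->
  f x @[x --> a^'+] --> f a ->
  (forall t, a < t <= b -> is_derive t 1 f (f' t)) ->
  (forall t, a < t <= b -> f' t <= 0) -> f b <= f a.
Proof.
rewrite le_eqVlt => /predU1P[->//|ab] fa df f0.
have cf t : a < t <= b -> {for t, continuous f}.
  move=> /df [fd _]; apply/differentiable_continuous.
  exact/derivable1_diffP.
have [||c cab] := @MVT _ f f' a b ab.
- by move=> x; rewrite in_itv/= => /andP[ax /ltW xb]; apply: df; rewrite ax.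
- apply/continuous_within_itvP => //; split=> //.
    by move=> x; rewrite in_itv/= => /andP[ax /ltW xb]; apply: cf; rewrite ax.
  by apply: cvg_at_left_filter; apply: cf; rewrite ab lexx.
rewrite in_itv/= in cab; case/andP: cab => ac /ltW cb e.
by rewrite -subr_le0 e mulr_le0_ge0 ?subr_ge0 ?(ltW ab)// f0// ac.
Qed.

Lemma half_line_nonincreasing f f' (s t : R) :
  half_line_derive f f' -> (forall t, 0 < t -> f' t <= 0) ->
  0 <= s <= t -> f t <= f s.
Proof.
move=> [f0 df] f'0 /andP[s0 st]; apply: (@le_of_derive_le0 f f') => //.
- move: s0; rewrite le_eqVlt => /predU1P[<-//|/df[fd _]].
  apply: cvg_at_right_filter; apply/differentiable_continuous.
  exact/derivable1_diffP.
- by move=> x /andP[sx _]; apply: df; exact: le_lt_trans sx.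
- by move=> x /andP[sx _]; apply: f'0; exact: le_lt_trans sx.
Qed.

Lemma half_line_cst f f' (t : R) : half_line_derive f f' ->
  (forall t, 0 < t -> f' t = 0) -> 0 <= t -> f t = f 0.
Proof.
move=> df f'0 t0; apply/le_anti/andP; split.
  by apply: half_line_nonincreasing df _ _; rewrite ?lexx// => s /f'0 ->.
rewrite -lerN2 -[- f 0]mulN1r -[- f t]mulN1r.
apply: half_line_nonincreasing
  (half_line_deriveM (half_line_derive_cst (-1)) df) _ _.
  by move=> s /f'0 ->; rewrite mul0r mulr0 addr0.
by rewrite lexx.
Qed.

(** As long as V > 0, the derivative of V^(1 - beta) is at most
    - c (1 - beta); were V(t) positive at a time t past the bound,
    V(t)^(1 - beta) would be nonpositive. *)
Lemma finite_time_extinction (V V' : R -> R) (c beta : R) :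
  0 < c -> beta < 1 -> half_line_derive V V' ->
  (forall t, 0 <= t -> 0 <= V t) ->
  (forall t, 0 < t -> V' t <= - c * V t `^ beta) ->
  forall t, V 0 `^ (1 - beta) / (c * (1 - beta)) <= t -> V t = 0.
Proof.
move=> c0 b1 dV V0 dVle b; have b0 : 0 < 1 - beta by rewrite subr_gt0.
have cb : 0 < c * (1 - beta) by exact: mulr_gt0.
rewrite ler_pdivrMr// => Tb.
have bge0 : 0 <= b.
  by rewrite -(pmulr_lge0 _ cb) (le_trans _ Tb)// powR_ge0.
apply/eqP/negPn/negP => Vb.
have {}Vb : 0 < V b by rewrite lt_neqAle eq_sym Vb V0.
have Vpos s : 0 <= s <= b -> 0 < V s.
  move=> sb; apply: lt_le_trans Vb _; apply: half_line_nonincreasing dV _ sb.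
  move=> t t0; apply: le_trans (dVle t t0) _.
  by rewrite mulNr oppr_le0 mulr_ge0 ?powR_ge0// ltW.
pose W t := V t `^ (1 - beta) + c * (1 - beta) * t.
have : W b <= W 0.
  have cV x : 0 < x -> {for x, continuous (fun x : R => x `^ (1 - beta))}.
    move=> x0; have [pd _] := is_derive1_powR (1 - beta) x0.
    by apply/differentiable_continuous/derivable1_diffP.
  apply: (@le_of_derive_le0 W (fun t =>
      (1 - beta) * V t `^ (- beta) * V' t + c * (1 - beta))) => //.
  - apply: cvgD.
      have V00 : 0 < V 0 by apply: Vpos; rewrite lexx.
      exact: (cvg_comp V (fun x => x `^ (1 - beta)) dV.1 (cV _ V00)).
    by apply: cvgM; [exact: cvg_cst|exact: cvg_within].
  - move=> t /andP[t0 tb].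
    have Vt : 0 < V t by apply: Vpos; rewrite ltW.
    have dVt := dV.2 t t0; have dp := is_derive1_powR (1 - beta) Vt.
    have := is_derive1_comp dp dVt; rewrite addrAC subrr add0r => d1.
    have d2 : is_derive t 1 (fun t : R => c * (1 - beta) * t) (c * (1 - beta)).
      have := is_deriveZ (c * (1 - beta)) (is_derive_id t 1).
      by rewrite [X in is_derive _ _ _ X]mulr1.
    exact: is_deriveD.
  - move=> t /andP[t0 tb].
    have Vt : 0 < V t by apply: Vpos; rewrite ltW.
    have : (1 - beta) * V t `^ (- beta) * V' t <=
        (1 - beta) * V t `^ (- beta) * (- c * V t `^ beta).
      by rewrite ler_wpM2l ?dVle// mulr_ge0 ?powR_ge0 ?ltW.
    rewrite powRN (_ : _ * (- c * _) = - (c * (1 - beta))).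
      by lra.
    by field; rewrite powR_eq0 gt_eqF.
rewrite /W mulr0 addr0 => H.
have : 0 < V b `^ (1 - beta) by rewrite powR_gt0.
by rewrite mulrC in Tb; lra.
Qed.

End half_line_derivatives.

(** * Finite-time consensus on a connected graph *)

Section consensus.
Context {R : realType} (n : nat) (E : rel 'I_n).
Hypothesis E_undirected : symmetric E.
Hypothesis E_connected : forall i j, connect E i j.

(** Summation by parts on an undirected graph: average the sum with the one
    obtained by exchanging the ends of every edge. *)
Lemma edge_sum_by_parts (k : 'I_n -> 'I_n -> R) (x y : 'I_n -> R) :
  (forall i j, k i j = k j i) ->
  (\sum_i \sum_(j | E i j) k i j * (y i * (x j - x i))) *+ 2 =
  - \sum_i \sum_(j | E i j) k i j * ((y j - y i) * (x j - x i)).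
Proof.
move=> kC.
have swap : \sum_i \sum_(j | E i j) k i j * (y i * (x j - x i)) =
    \sum_i \sum_(j | E i j) k i j * (y j * (x i - x j)).
  under eq_bigr do rewrite big_mkcond; rewrite exchange_big.
  apply: eq_bigr => i _; rewrite [RHS]big_mkcond; apply: eq_bigr => j _.
  by rewrite E_undirected kC.
rewrite mulr2n {2}swap -big_split -sumrN; apply: eq_bigr => i _.
by rewrite -big_split -sumrN; apply: eq_bigr => j _ /=; ring.
Qed.

(** A simple path has fewer than n edges. *)
Lemma dist_le_of_edges (x : 'I_n -> R) (r : R) : 0 <= r ->
  (forall i j, E i j -> `|x i - x j| <= r) ->
  forall i j, `|x i - x j| <= n%:R * r.
Proof.
move=> r0 xE i j; have /connectP[p pE ->] := E_connected i j.
case/shortenP: pE => {}p pE up _.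
have {up} /card_uniqP cp := up; have : (size p < n)%N.
  by have := max_card (mem (i :: p)); rewrite cp card_ord.
move=> /ltnW sn; apply: (@le_trans _ _ ((size p)%:R * r)); last first.
  by rewrite ler_wpM2r// ler_nat.
elim: p i pE {cp sn} => [|k p IH] i /=; first by rewrite subrr normr0 mul0r.
move=> /andP[ik /IH kp]; rewrite -natr1 mulrDl mul1r [leRHS]addrC.
rewrite -(subrK (x k) (x i)) -addrA (le_trans (ler_normD _ _))// lerD//.
exact: xE.
Qed.

Lemma le_sum_term (I : finType) (P : pred I) (F : I -> R) i :
  P i -> (forall i, 0 <= F i) -> F i <= \sum_(i | P i) F i.
Proof. by move=> Pi F0; rewrite (bigD1 i)//= lerDl sumr_ge0. Qed.

Section lyapunov.
Variables (m p : nat).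
Implicit Types (X : 'I_n -> 'M[R]_(m, p)) (M : 'M[R]_(m, p)).

Lemma normr_entry_le (A : 'M[R]_(m, p)) a b : `|A a b| <= frobnorm A.
Proof.
rewrite -sqrtr_sqr ler_sqrt ?sumr_ge0//; last first.
  by move=> i _; apply: sumr_ge0 => j _; rewrite sqr_ge0.
apply: le_trans (le_sum_term (i := a) _ _) => //.
  by apply: (@le_sum_term _ _ (fun j => A a j ^+ 2) b) => // j; rewrite sqr_ge0.
by move=> i; apply: sumr_ge0 => j _; rewrite sqr_ge0.
Qed.

Lemma frobnormN (A : 'M[R]_(m, p)) : frobnorm (- A) = frobnorm A.
Proof.
congr Num.sqrt; apply: eq_bigr => i _; apply: eq_bigr => j _.
by rewrite mxE sqrrN.
Qed.

Definition disagreement M X : R := \sum_i \sum_a \sum_b (X i a b - M a b) ^+ 2.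

Definition dissipation (alpha : R) X : R :=
  \sum_i \sum_(j | E i j) frobnorm (X j - X i) `^ (2 - alpha).

Lemma disagreement_ge0 M X : 0 <= disagreement M X.
Proof.
by do 3!(apply: sumr_ge0 => ? _); rewrite sqr_ge0.
Qed.

Lemma disagreement_eq0 M X i : disagreement M X = 0 -> X i = M.
Proof.
move=> /eqP; rewrite psumr_eq0; last first.
  by move=> k _; do 2!(apply: sumr_ge0 => ? _); rewrite sqr_ge0.
move=> /allP/(_ i (mem_index_enum _))/=.
rewrite psumr_eq0; last first.
  by move=> k _; apply: sumr_ge0 => ? _; rewrite sqr_ge0.
move=> Xi; apply/matrixP => a b.
move/allP: Xi => /(_ a (mem_index_enum _))/=.
rewrite psumr_eq0; last by move=> k _; rewrite sqr_ge0.
move=> /allP/(_ b (mem_index_enum _))/=; rewrite sqrf_eq0 subr_eq0.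
by move/eqP.
Qed.

(* n m p squares, each at most (n r)^2; adding 1 makes K positive even when a
   dimension is 0. *)
Let K : R := (n * (m * p))%:R * n%:R ^+ 2 + 1.

Let K_gt0 : 0 < K.
Proof. by rewrite ltr_wpDl// mulr_ge0// exprn_ge0. Qed.

(** Let D be the dissipation and r = D^(1/(2 - alpha)). No edge difference
    exceeds r, so by connectedness no entry of X_i - X_j, and hence none of
    X_i - M, exceeds n r in absolute value. This bounds the disagreement by
    K r^2, whose power 1 - alpha/2 is K^(1 - alpha/2) D. *)
Lemma disagreement_le (alpha : R) M X : alpha < 1 ->
  (forall a b, \sum_i X i a b = n%:R * M a b) ->
  disagreement M X `^ (1 - alpha / 2) <=
  K `^ (1 - alpha / 2) * dissipation alpha X.
Proof.
move=> a1 XM; have a2 : 0 < 2 - alpha by lra.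
set D := dissipation alpha X.
have D0 : 0 <= D.
  by apply: sumr_ge0 => i _; apply: sumr_ge0 => j _; rewrite powR_ge0.
pose r := D `^ (2 - alpha)^-1.
have r0 : 0 <= r by rewrite powR_ge0.
have rD : r `^ (2 - alpha) = D by rewrite /r -powRrM mulVf ?gt_eqF// powRr1.
have edge i j : E i j -> frobnorm (X j - X i) <= r.
  move=> ij; rewrite leNgt; apply/negP => /(gt0_ltr_powR a2).
  rewrite !nnegrE frobnorm_ge0 rD => /(_ r0 isT); apply/negP; rewrite -leNgt.
  apply: le_trans (le_sum_term (i := i) _ _) => //.
    pose F k := frobnorm (X k - X i) `^ (2 - alpha).
    apply: (@le_sum_term _ _ F j) => //.
    by move=> k; exact: powR_ge0.
  by move=> k; apply: sumr_ge0 => ? _; rewrite powR_ge0.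
have XX i j a b : `|X i a b - X j a b| <= n%:R * r.
  apply: (@dist_le_of_edges (fun i => X i a b)) => // {}i {}j ij.
  apply: le_trans (edge i j ij); rewrite distrC.
  by have := normr_entry_le (X j - X i) a b; rewrite !mxE.
have XMr i a b : `|X i a b - M a b| <= n%:R * r.
  have n0 : (0 < n%:R :> R) by rewrite ltr0n (leq_ltn_trans (leq0n i)).
  rewrite -(ler_pM2l n0) -{1}(ger0_norm (ltW n0)) -normrM mulrBr -XM.
  rewrite (_ : _ - _ = \sum_j (X i a b - X j a b)); last first.
    by rewrite sumrB sumr_const card_ord mulr_natl.
  apply: le_trans (ler_norm_sum _ _ _) _.
  rewrite -[n in n%:R * (_ * _)]card_ord mulr_natl -sumr_const.
  by apply: ler_sum => j _.
have VK : disagreement M X <= K * r ^+ 2.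
  apply: (@le_trans _ _
    (\sum_(i < n) \sum_(a < m) \sum_(b < p) (n%:R * r) ^+ 2)).
    apply: ler_sum => i _; apply: ler_sum => a _; apply: ler_sum => b _.
    by rewrite -real_normK ?num_real// lerXn2r// nnegrE mulr_ge0.
  rewrite (_ : \sum_(i < n) _ = (n * (m * p))%:R * (n%:R * r) ^+ 2); last first.
    rewrite !sumr_const !card_ord -!mulrnA [RHS]mulr_natl; congr (_ *+ _).
    by rewrite mulnC -mulnA mulnCA.
  by rewrite exprMn [leLHS]mulrA ler_wpM2r ?exprn_ge0// lerDl.
have b0 : 0 <= 1 - alpha / 2 by lra.
apply: (@le_trans _ _ ((K * r ^+ 2) `^ (1 - alpha / 2))).
  apply: ge0_ler_powR => //; first by rewrite nnegrE disagreement_ge0.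
  by rewrite nnegrE mulr_ge0 ?exprn_ge0// ltW.
rewrite powRM ?exprn_ge0//; last exact: ltW.
rewrite -powR_mulrn// -powRrM (_ : 2%:R * _ = 2 - alpha) ?rD//.
by field.
Qed.

Variable alpha : R.
Hypothesis halpha : 0 < alpha < 1.
Variable S : 'I_n -> R -> 'M[R]_(m, p).
Let weight i j t : R := (frobnorm (S j t - S i t) `^ alpha)^-1.
Hypothesis S_flow : forall i a b, half_line_derive (fun t => S i t a b)
  (fun t => \sum_(j | E i j) weight i j t * (S j t a b - S i t a b)).

Let weightC i j t : weight i j t = weight j i t.
Proof. by rewrite /weight -frobnormN opprB. Qed.

Let M : 'M[R]_(m, p) := n%:R^-1 *: \sum_i S i 0.

(** Summation by parts against the constant 1 shows that the sum of the S_i has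
    derivative 0. *)
Lemma consensus_sum_cst (t : R) a b : 0 <= t -> \sum_i S i t a b = n%:R * M a b.
Proof.
move=> t0; transitivity (\sum_i S i 0 a b); last first.
  rewrite mxE summxE; have [n0|n0] := eqVneq (n%:R : R) 0.
    rewrite n0 mul0r big1// => i _.
    by move/eqP: n0; rewrite pnatr_eq0 -leqn0 leqNgt (leq_ltn_trans (leq0n i)).
  by rewrite mulVKf.
have := half_line_derive_sum (index_enum 'I_n) (fun i => S_flow i a b).
move=> /half_line_cst; apply => // s s0.
have /eqP := edge_sum_by_parts (fun i => S i s a b) (fun=> 1)
  (fun i j => weightC i j s).
rewrite [in X in _ == X]big1 => [|i _]; last first.
  by rewrite big1// => j _; rewrite subrr mul0r mulr0.
rewrite oppr0 mulrn_eq0 /= => /eqP e; rewrite -[RHS]e.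
by apply: eq_bigr => i _; apply: eq_bigr => j _; rewrite mul1r.
Qed.

(** Summation by parts against S_i - M turns the derivative into a sum over the
    edges of weight times squared difference, and the weight lowers the exponent
    2 to 2 - alpha. *)
Lemma disagreement_derive :
  half_line_derive (fun t => disagreement M (S^~ t))
    (fun t => - dissipation alpha (S^~ t)).
Proof.
have d : half_line_derive (fun t => disagreement M (S^~ t)) (fun t =>
    \sum_i \sum_a \sum_b ((S i t a b - M a b) *
      (\sum_(j | E i j) weight i j t * (S j t a b - S i t a b))) *+ 2).
  do 3!apply: half_line_derive_sum => ?.
  apply: half_line_derive_eq; last first.
    have d := half_line_deriveD (S_flow _ _ _) (half_line_derive_cst (- M _ _)).
    exact: half_line_deriveM (d _ _ _ _ _) (d _ _ _ _ _).
  by move=> t t0 /=; ring.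
apply: half_line_derive_eq d => t t0.
transitivity (\sum_a \sum_b
    - \sum_i \sum_(j | E i j) weight i j t * (S j t a b - S i t a b) ^+ 2).
  rewrite exchange_big; apply: eq_bigr => a _.
  rewrite exchange_big; apply: eq_bigr => b _ /=.
  transitivity ((\sum_i \sum_(j | E i j) weight i j t *
      ((S i t a b - M a b) * (S j t a b - S i t a b))) *+ 2).
    rewrite -sumrMnl; apply: eq_bigr => i _; congr (_ *+ 2).
    by rewrite mulr_sumr; apply: eq_bigr => j _; rewrite mulrCA.
  rewrite (edge_sum_by_parts (fun i => S i t a b) (fun i => S i t a b - M a b)
    (fun i j => weightC i j t)).
  congr (- _); apply: eq_bigr => i _; apply: eq_bigr => j _.
  by congr (_ * _); ring.
under eq_bigr do rewrite sumrN.
rewrite sumrN; congr (- _).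
under eq_bigr do rewrite exchange_big.
rewrite exchange_big; apply: eq_bigr => i _ /=.
under eq_bigr do rewrite exchange_big.
rewrite exchange_big; apply: eq_bigr => j _ /=.
have [a0 a1] := andP halpha.
transitivity (weight i j t * frobnorm (S j t - S i t) ^+ 2).
  rewrite sqr_frobnorm mulr_sumr; apply: eq_bigr => a _.
  by rewrite mulr_sumr; apply: eq_bigr => b _; rewrite !mxE.
rewrite -powR_mulrn ?frobnorm_ge0// mulrC powRB//.
by apply/implyP => /eqP; lra.
Qed.

Lemma finite_time_consensus :
  exists2 T0, 0 <= T0 & forall t i, T0 <= t -> S i t = M.
Proof.
have [a0 a1] := andP halpha.
pose beta := 1 - alpha / 2; pose c := (K `^ beta)^-1.
have c0 : 0 < c by rewrite invr_gt0 powR_gt0.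
have b1 : beta < 1 by rewrite /beta; lra.
have extinct := finite_time_extinction c0 b1 disagreement_derive.
exists (disagreement M (S^~ 0) `^ (1 - beta) / (c * (1 - beta))).
  by rewrite divr_ge0 ?powR_ge0// mulr_ge0 ?ltW// subr_gt0.
move=> t i Tt; apply: (@disagreement_eq0 _ (S^~ t)).
apply: extinct Tt => [s _|s s0].
  exact: disagreement_ge0.
rewrite mulNr lerN2 /c mulrC ler_pdivrMr ?powR_gt0// mulrC.
apply: disagreement_le => // a b; apply: consensus_sum_cst; exact: ltW.
Qed.

End lyapunov.
End consensus.

(** * The localization law *)

Section inertial_frame.
Context {R : realType}.

Lemma half_line_derive_mulmx (F F' G G' : R -> 'M[R]_(3 + 1)) a b :
  is_derive_ge0 F F' -> is_derive_ge0 G G' ->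
  half_line_derive (fun t => (F t *m G t) a b)
                   (fun t => (F t *m G' t + F' t *m G t) a b).
Proof.
move=> dF dG.
rewrite (_ : (fun t => (F t *m G t) a b) =
    (fun t => \sum_k F t a k * G t k b)); last first.
  by apply/funext => t; rewrite mxE.
apply: half_line_derive_eq; last first.
  apply: half_line_derive_sum => k.
  exact: half_line_deriveM (half_line_derive_entry a k dF)
                           (half_line_derive_entry k b dG).
by move=> t _; rewrite !mxE big_split.
Qed.

(** The derivative of T_i P_i is T_i P_i' + T_i W_i P_i, where the velocity term
    - W_i P_i of P_i' cancels the second summand. *)
Lemma inertial_flow n (alpha : R) (E : rel 'I_n)
    (T : 'I_n -> R -> 'M[R]_(3 + 1)) (v w : 'I_n -> R -> 'cV[R]_3)
    (Q : 'I_n -> R -> 'M[R]_3) (q : 'I_n -> R -> 'cV[R]_3) :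
  (forall i t, 0 <= t -> SE3 (T i t)) ->
  (forall i, is_derive_ge0 (T i) (fun t => T i t *m wedge (v i t) (w i t))) ->
  localization_law alpha E T v w (fun i t => homog (Q i t) (q i t)) ->
  let S i t := T i t *m homog (Q i t) (q i t) in
  forall i a b, half_line_derive (fun t => S i t a b)
    (fun t => \sum_(j | E i j)
       (frobnorm (S j t - S i t) `^ alpha)^-1 * (S j t a b - S i t a b)).
Proof.
move=> TSE dT law S i a b.
apply: half_line_derive_eq (half_line_derive_mulmx a b (dT i) (law i)) => t t0.
rewrite mulmxDr mulNmx mulmxN mulmxA addrAC addNr add0r mulmx_sumr summxE.
apply: eq_bigr => j _; rewrite /S.
have [Ai [bi [SAi ->]]] := TSE i t (ltW t0).
have [Aj [bj [SAj ->]]] := TSE j t (ltW t0).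
by rewrite mul_homog_coupling// !mxE.
Qed.

Lemma homog_mean n (A : 'I_n -> 'M[R]_3) (b : 'I_n -> 'cV[R]_3) : (0 < n)%N ->
  n%:R^-1 *: \sum_i homog (A i) (b i) =
  homog (n%:R^-1 *: \sum_i A i) (n%:R^-1 *: \sum_i b i).
Proof.
move=> n0; have -> : \sum_i homog (A i) (b i) =
    block_mx (\sum_i A i) (\sum_i b i) 0 (\sum_(i < n) 1%:M) :> 'M[R]_(3 + 1).
  elim: (index_enum 'I_n) => [|i r IH]; first by rewrite !big_nil block_mx0.
  by rewrite !big_cons IH add_block_mx addr0.
rewrite /homog scale_block_mx scaler0; congr block_mx.
rewrite sumr_const card_ord -[1%:M *+ n]scaler_nat scalerA mulVf ?scale1r//.
by rewrite pnatr_eq0 -lt0n.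
Qed.

(** Agreement means Q = A^T Y and q = A^T (p - b), so gsop Q = A^T gsop Y. *)
Lemma estimated_pose_consensus (A Y : 'M[R]_3) (b p : 'cV[R]_3) Q q :
  SO3 A -> \det Y != 0 -> homog A b *m homog Q q = homog Y p ->
  estimated_pose Q q = invmx (homog (gsop Y) p) *m homog A b.
Proof.
move=> SA dY; rewrite homogM => /homog_inj[AQ Aq].
have SY := gsop_SO3 dY.
have QE : Q = A^T *m Y by rewrite -AQ mulmxA SA.1 mul1mx.
have qE : q = A^T *m (p - b) by rewrite -Aq addrK mulmxA SA.1 mul1mx.
rewrite /estimated_pose QE gsop_mulmx; last exact: SO3_trmx.
rewrite trmx_mul trmxK qE invmx_homog// homogM; congr homog.
by rewrite !mulmxA -(mulmxA _ A) (SO3_mulmx_tr SA) mulmx1 mulmxBr opprB.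
Qed.

End inertial_frame.

Theorem corollary3 (R : realType) (n : nat) (alpha : R)
    (halpha : 0 < alpha < 1)
    (E : rel 'I_n) (E_undirected : symmetric E)
    (E_connected : forall i j, connect E i j)
    (T : 'I_n -> R -> 'M[R]_(3 + 1))
    (v w : 'I_n -> R -> 'cV[R]_3)
    (T_SE3 : forall i t, 0 <= t -> SE3 (T i t))
    (T_kinematics : forall i,
      is_derive_ge0 (T i) (fun t => T i t *m wedge (v i t) (w i t))) :
  {ae @lebesgue_tuple R #|{: entry_index n}|, forall x,
    forall (Q : 'I_n -> R -> 'M[R]_3) (q : 'I_n -> R -> 'cV[R]_3),
      (forall i, row_mx (Q i 0) (q i 0) = entries x i) ->
      localization_law alpha E T v w (fun i t => homog (Q i t) (q i t)) ->
      exists Tc : 'M[R]_(3 + 1), SE3 Tc /\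
        exists T0 : R, 0 <= T0 /\
          forall t i, T0 <= t ->
            estimated_pose (Q i t) (q i t) = invmx Tc *m T i t}.
Proof.
(* Without agents the determinant of the empty sum is 0, but the conclusion is
   void. *)
have [n0|n0] := posnP n.
  exists set0; split=> //; first exact: lebesgue_tuple0.
  move=> x; apply: contra_notP => _ Q q _ _; exists 1%:M; split.
    exists 1%:M, 0; rewrite homog1; split=> //.
    by split; [rewrite trmx1 mulmx1|exact: det1].
  by exists 0; split=> // t i; have := ltn_ord i; rewrite {2}n0.
have [B [b TB]] : exists B b, forall i, SO3 (B i) /\ T i 0 = homog (B i) (b i).
  by have /choice[B /choice[b TB]] := fun i => T_SE3 i 0 (lexx _); exists B, b.
have [N [mN N0 sN]] := @det_weighted_sum_ae R n B n0 (fun i => (TB i).1).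
exists N; split=> // x; apply: contra_notP => Nx Q q Q0 law.
have dW : \det (weighted_sum B x) != 0.
  by apply/eqP => dW; apply: Nx; apply: sN => /=; rewrite dW eqxx.
have [T0 T00 S_const] := finite_time_consensus E_undirected E_connected halpha
  (inertial_flow T_SE3 T_kinematics law).
pose Y : 'M[R]_3 := n%:R^-1 *: weighted_sum B x.
pose p : 'cV[R]_3 := n%:R^-1 *: \sum_i (B i *m q i 0 + b i).
have dY : \det Y != 0.
  by rewrite detZ mulf_neq0// expf_neq0// invr_eq0 pnatr_eq0 -lt0n.
have mean_S : n%:R^-1 *: \sum_i T i 0 *m homog (Q i 0) (q i 0) = homog Y p.
  rewrite -homog_mean//; congr (_ *: _); apply: eq_bigr => i _.
  by rewrite (TB i).2 homogM -Q0 row_mxKl.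
exists (homog (gsop Y) p); split.
  by exists (gsop Y), p; split=> //; exact: gsop_SO3.
exists T0; split=> // t i T0t.
have [A [c [SA TA]]] := T_SE3 i t (le_trans T00 T0t).
have := S_const t i T0t; rewrite /= mean_S TA.
exact: estimated_pose_consensus.
Qed.
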